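(* Let $d,n\in\mathbb{N}$ and let $$n = [m_d,\ell_d]^d + [m_{d-1},\ell_{d-1}]^{d-1} + \cdots + [m_c,\ell_c]^c$$ be the pseudo $d$-cubic representation ($d$-PCR) of $n$. Then the maximum number $E_d(n)$ of edges that a set $S\subseteq\mathbb{N}^d$ with $|S|=n$ can induce in the grid graph is $$E_d(n) = dn-\delta_d(n),\qquad \delta_d(n) = \sum_{i=c}^d\Bigl(\ell_i[m_i,\ell_i-1]^{i-1} + (i-\ell_i)[m_i,\ell_i]^{i-1}\Bigr).$$
   Context: $\mathbb{N}=\{1,2,3,\ldots\}$. The grid graph $\mathbb{Z}^d$ has vertex set $\mathbb{Z}^d$, with $\tilde{x},\tilde{y}$ adjacent iff $\sum_{i=1}^d|x_i-y_i|=1$; $\mathbb{N}^d$ is its induced subgraph. For finite $S\subseteq\mathbb{Z}^d$, $E_d(S)$ is the number of edges of the subgraph induced by $S$, and $E_d(n)=\max\{E_d(S): S\subseteq\mathbb{Z}^d,\ |S|=n\}$ (by translation one may equivalently take $S\subseteq\mathbb{N}^d$). For integers $m\ge 1$, $j\ge 0$ and $\ell$, write $[m,\ell]^j := (m+1)^{\ell}m^{j-\ell}$, interpreted as this algebraic expression also when $\ell=j$ or $\ell=-1$ (when $\ell_i=0$ the term $\ell_i[m_i,\ell_i-1]^{i-1}$ is $0$). A pseudo $j$-cubic ($j\in\mathbb{N}$) is a number of the form $[m,\ell]^j$ with $m\in\mathbb{N}$ and $\ell\in\{0,1,\ldots,j-1\}$. Every $n\in\mathbb{N}$ has a unique pseudo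 $d$-cubic representation ($d$-PCR): $n=[m_d,\ell_d]^d+[m_{d-1},\ell_{d-1}]^{d-1}+\cdots+[m_c,\ell_c]^c$ with $1\le c\le d$, one term $[m_i,\ell_i]^i$ for each $i\in\{c,\ldots,d\}$, where each $m_i\in\mathbb{N}$, $\ell_i\in\{0,\ldots,i-1\}$, and $(m_d,\ell_d)>(m_{d-1},\ell_{d-1})>\cdots>(m_c,\ell_c)$ strictly in lexicographic order. *)

(* Defs.v *)
From mathcomp Require Export all_boot all_order all_algebra.
From mathcomp Require Export finmap.

Set Implicit Arguments.
Unset Strict Implicit.
Unset Printing Implicit Defensive.

Import Order.TTheory GRing.Theory Num.Theory.

Local Open Scope ring_scope.

Definition grid (d : nat) : choiceType := {ffun 'I_d -> int}.

Definition grid_adj (d : nat) : rel (grid d) :=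
  fun x y => \sum_(i < d) `|x i - y i| == 1.

(* N^d, where N = {1, 2, 3, ...} *)
Definition pos_grid (d : nat) : pred (grid d) :=
  fun x => [forall i, 0 < x i].

(* An edge is the unordered pair of its endpoints; grid_adj is irreflexive, so
   these are two-element sets. *)
Definition induced_edges (d : nat) (S : {fset grid d}) : {set {set S}} :=
  [set e : {set S} | [exists x : S, exists y : S,
     grid_adj (val x) (val y) && (e == [set x; y])]].

Definition num_edges (d : nat) (S : {fset grid d}) : nat := #|induced_edges S|.

Definition is_max_edges (d n : nat) (V : pred (grid d)) (e : nat) : Prop :=
  (exists S : {fset grid d},
     [/\ {subset S <= V}, #|` S| = n & num_edges S = e]) /\
  (forall S : {fset grid d},
     {subset S <= V} -> #|` S| = n -> (num_edges S <= e)%N).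

(* [m, l]^j = (m+1)^l m^(j-l); the exponents are integers (and the value a
   rational) so that l = -1 is covered. *)
Definition bracket (m : nat) (l : int) (j : nat) : rat :=
  m.+1%:R ^ l * m%:R ^ (j%:Z - l).

(* Only the values m i, l i for c <= i <= d are relevant. *)
Definition is_PCR (d n c : nat) (m l : nat -> nat) : Prop :=
  [/\ (1 <= c <= d)%N,
      forall i, (c <= i <= d)%N -> (1 <= m i)%N /\ (l i < i)%N,
      forall i, (c <= i < d)%N ->
        ((m i, l i) < (m i.+1, l i.+1) :> (nat *l nat))%O
    & n%:R = \sum_(c <= i < d.+1) bracket (m i) (l i)%:Z i].

Definition delta (d c : nat) (m l : nat -> nat) : rat :=
  \sum_(c <= i < d.+1)
     ((l i)%:R * bracket (m i) ((l i)%:Z - 1) i.-1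
      + (i%:R - (l i)%:R) * bracket (m i) (l i)%:Z i.-1).

(* Main.v *)
Require Import Defs.
From mathcomp Require Import all_boot all_order all_algebra.
From mathcomp Require Import finmap zify.

Set Implicit Arguments.
Unset Strict Implicit.
Unset Printing Implicit Defensive.

Import Order.TTheory GRing.Theory Num.Theory.

(** Counting, for each direction, the points of [S] whose upper neighbour is
    missing from [S] ("tops") gives [E(S) = d n - #tops(S)], so the number of
    tops has to be minimised.  Cutting [S] into parallel layers of sizes
    [a_1, .., a_k] yields the lower bound [\sum_j delta_(d-1)(a_j) + max_j a_j],
    since every layer projects injectively to the tops in the cutting direction.
    It remains to show that this is at least [delta_d(\sum_j a_j)].

    If [n <= k^d], remove the smallest layer; otherwise the largest layer is
    [D + r] with [D] a pseudo-cube, and the parts [a_j - D] of all layers are cut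
    off, forming together a layer in another direction.  In both cases the piece
    [c] that is removed satisfies [M c <= n - c] and [n <= (M+1)^d] for some
    [M > 0], which suffices for
    [delta_d(n) <= delta_d(n - c) + delta_(d-1)(c)].  The latter rests on two
    properties of [delta], proved together by induction on the dimension:
    subadditivity, and the inequality
    [delta(A) + delta(a + b - A) <= delta(a) + delta(b)] for [A] a pseudo-cube,
    [a, b <= A <= a + b].

    Equality holds for a pseudo-cube with an optimal lower-dimensional set
    attached to one of its faces. *)

(** * Pseudo-cubes and the function delta *)

Definition box (m l j : nat) : nat := m.+1 ^ l * m ^ (j - l).

(** Sum over the directions of the facet sizes of a box with [l] sides [m.+1] and [j - l] sides [m].
    For [l = 0] the truncated [l.-1] is harmless, its factor being [0]. *)
Definition surf (m l j : nat) : nat :=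
  l * box m l.-1 j.-1 + (j - l) * box m l j.-1.

Lemma box_gt0 m l j : 0 < m -> 0 < box m l j.
Proof. by move=> m0; rewrite muln_gt0 !expn_gt0 m0. Qed.

Lemma boxMl m l d : l <= d -> box m l d.+1 = m * box m l d.
Proof. by move=> ld; rewrite /box subSn // expnS mulnCA. Qed.

Lemma boxMSl m l d : box m l.+1 d.+1 = m.+1 * box m l d.
Proof. by rewrite /box subSS expnS mulnA. Qed.

Lemma boxS m l d : l <= d -> box m l.+1 d.+1 = box m l d.+1 + box m l d.
Proof. by move=> ld; rewrite boxMSl boxMl // mulSn addnC. Qed.

Lemma box0 m d : box m 0 d = m ^ d.
Proof. by rewrite /box expn0 mul1n subn0. Qed.

Lemma box_full m d : box m d d = m.+1 ^ d.
Proof. by rewrite /box subnn expn0 muln1. Qed.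

Lemma ltn_boxS m l d : 0 < m -> l < d -> box m l d < box m l.+1 d.
Proof.
case: d => // d m0 ld; rewrite boxS // -addn1 leq_add2l.
exact: box_gt0.
Qed.

Lemma leq_box m l l' d : 0 < m -> l <= l' -> l' <= d -> box m l d <= box m l' d.
Proof.
move=> m0 /subnKC <-; elim: (l' - l) => [|k IH] h; first by rewrite addn0.
rewrite addnS; apply: (@leq_trans (box m (l + k) d)); first by apply: IH; lia.
by apply: ltnW; apply: ltn_boxS; lia.
Qed.

Lemma ltn_box m l l' d : 0 < m -> l < l' -> l' <= d -> box m l d < box m l' d.
Proof.
move=> m0 ll ld; apply: (@leq_trans (box m l.+1 d)); first by apply: ltn_boxS => //; lia.
exact: leq_box.
Qed.

Lemma leq_cube_box m l d : 0 < m -> l <= d -> m ^ d <= box m l d.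
Proof. by move=> m0 ld; rewrite -box0 leq_box. Qed.

Lemma leq_box_cube m l d : 0 < m -> l <= d -> box m l d <= m.+1 ^ d.
Proof. by move=> m0 ld; rewrite -box_full leq_box. Qed.

Lemma ltn_box_cube m l d : 0 < m -> l < d -> box m l d < m.+1 ^ d.
Proof. by move=> m0 ld; rewrite -box_full ltn_box. Qed.

Lemma box_lex m l m' l' d : 0 < m' -> l' < d -> l <= d ->
  m' < m \/ m' = m /\ l' < l -> box m' l'.+1 d <= box m l d.
Proof.
move=> m0 ld' ld [mm|[e ll]]; last by subst m'; apply: leq_box.
apply: leq_trans (leq_box_cube m0 _) _ => //.
have m1 : 0 < m by lia.
apply: leq_trans (leq_cube_box m1 ld).
by case: d {ld ld'} => // d; rewrite leq_exp2r.
Qed.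

(** If [(m, l)] preceded [(m', l')] lexicographically, [box m l.+1 d.+1] would be at most
    [box m' l' d.+1]. So [(m', l')] comes no later, and the faces follow the same order. *)
Lemma leq_face m l m' l' d : 0 < m -> 0 < m' -> l <= d -> l' <= d ->
  box m' l' d.+1 < box m l.+1 d.+1 -> box m' l' d <= box m l d.
Proof.
move=> m0 m0' ld ld' lt.
have [e|ll|[e ll]] : [\/ m' < m, m < m' \/ m = m' /\ l < l' | m' = m /\ l' <= l].
- have [?|?|?] := ltngtP m' m; [exact: Or31|by apply: Or32; left|].
  by have [?|?] := leqP l' l; [apply: Or33|apply: Or32; right].
- apply: leq_trans (leq_box_cube m0' ld') _.
  apply: leq_trans (leq_cube_box m0 ld).
  by case: (d) => // d'; rewrite leq_exp2r.
- have := @box_lex m' l' m l d.+1 m0 ld (leqW ld') ll; lia.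
by rewrite e; apply: leq_box.
Qed.

(** Greedy choice of [m], then of [l]. The next pseudo-cube exceeds [n] and is larger by one face,
    which bounds [r]. *)
Lemma box_decomp d n : 0 < n ->
  exists m l r, [/\ 0 < m, l <= d, r < box m l d & n = box m l d.+1 + r].
Proof.
move=> n0.
have b1 : exists m, m ^ d.+1 <= n by exists 1; rewrite exp1n.
have ub1 m : m ^ d.+1 <= n -> m <= n.
  by apply: leq_trans; case: m => [//|m]; rewrite -{1}[m.+1]expn1 leq_pexp2l.
have [m mn mmax] := ex_maxnP b1 ub1.
have m0 : 0 < m by apply: mmax; rewrite exp1n.
have b2 : exists l, (l <= d) && (box m l d.+1 <= n).
  by exists 0; rewrite box0.
have ub2 l : (l <= d) && (box m l d.+1 <= n) -> l <= d by case/andP.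
have [l /andP[ld ln] lmax] := ex_maxnP b2 ub2.
exists m, l, (n - box m l d.+1); split=> //; last by lia.
suff : n < box m l.+1 d.+1 by rewrite boxS //; lia.
rewrite ltnNge; apply/negP => h; move: (ld).
rewrite leq_eqVlt => /orP[/eqP e|ld'].
  by have := mmax m.+1; rewrite -box_full -{1}e h ltnn => /(_ isT).
by have := lmax l.+1; rewrite ld' h ltnn => /(_ isT).
Qed.

(** Decomposing [n.-1] shifts the range of the remainder by one; a positive remainder lets an
    induction that strips it off descend. *)
Lemma box_decomp_pos d n : 1 < n ->
  exists m l r, [/\ 0 < m, l <= d, 0 < r <= box m l d & n = box m l d.+1 + r].
Proof.
move=> n1; have [|m [l [r [m0 ld lr e]]]] := @box_decomp d n.-1; first by lia.
by exists m, l, r.+1; split=> //; lia.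
Qed.

(* [maxside] and [maxlong] recover the pair [(m, l)] of the largest pseudo-cube
   below [n]; they are junk for [n = 0], where [del] is set to [0]. *)
Definition maxside (d n : nat) : nat := \max_(m < n.+1 | m ^ d <= n) m.

Definition maxlong (d m n : nat) : nat := \max_(l < d | box m l d <= n) l.

(** Greedy evaluation of the delta of a PCR, depending on [n] alone: the remainder left by the
    largest pseudo-cube is treated one dimension lower. *)
Fixpoint del (d n : nat) : nat :=
  if d is d'.+1 then
    if n == 0 then 0 else
    let m := maxside d n in let l := maxlong d m n in
    surf m l d + del d' (n - box m l d)
  else 0.

Lemma del_n0 d : del d 0 = 0.
Proof. by case: d. Qed.

Lemma maxside_box m l d n : 0 < m -> l <= d ->
  box m l d.+1 <= n -> n < box m l.+1 d.+1 -> maxside d.+1 n = m.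
Proof.
move=> m0 ld h1 h2.
have le1 : m ^ d.+1 <= n.
  by apply: leq_trans (leq_cube_box m0 _) h1; lia.
have mn : m < n.+1.
  rewrite ltnS; apply: leq_trans le1.
  by case: (m) m0 => // k _; rewrite -{1}[k.+1]expn1 leq_pexp2l.
apply/eqP; rewrite eqn_leq; apply/andP; split.
  apply/bigmax_leqP => i hi; rewrite -ltnS.
  rewrite -(@ltn_exp2r i m.+1 d.+1) //; apply: leq_ltn_trans hi _.
  by apply: leq_trans h2 (leq_box_cube _ _).
exact: (@leq_bigmax_cond _ _ _ (Ordinal mn)).
Qed.

Lemma maxlong_box m l d n : 0 < m -> l <= d ->
  box m l d.+1 <= n -> n < box m l.+1 d.+1 -> maxlong d.+1 m n = l.
Proof.
move=> m0 ld h1 h2; have ld' : l < d.+1 by lia.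
apply/eqP; rewrite eqn_leq; apply/andP; split; last first.
  exact: (@leq_bigmax_cond _ _ _ (Ordinal ld')).
apply/bigmax_leqP => i hi; rewrite leqNgt; apply/negP => li.
have := @leq_box m l.+1 i d.+1 m0 li; have := ltn_ord i; lia.
Qed.

Lemma del_box_add_lt m l d r : 0 < m -> l <= d -> r < box m l d ->
  del d.+1 (box m l d.+1 + r) = surf m l d.+1 + del d r.
Proof.
move=> m0 ld rb; have := box_gt0 l d.+1 m0; have := boxS m ld => bs b0.
rewrite [LHS]/= ifN; last by lia.
rewrite (@maxside_box m l) ?(@maxlong_box m l) //; try lia.
by rewrite addKn.
Qed.

Arguments del : simpl never.

Lemma del_boxn m l d : 0 < m -> l <= d -> del d (box m l d) = surf m l d.
Proof.
case: d => [|d] m0; first by rewrite leqn0 => /eqP ->.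
rewrite leq_eqVlt => /orP[/eqP ->|ld].
  have -> : box m d.+1 d.+1 = box m.+1 0 d.+1 + 0.
    by rewrite addn0 box0 box_full.
  rewrite del_box_add_lt // ?box_gt0 // del_n0 addn0.
  by rewrite /surf /= box_full box0 subnn mul0n addn0 add0n subn0.
by rewrite -{1}[box _ _ _]addn0 del_box_add_lt ?box_gt0 // del_n0 addn0.
Qed.

(** One side of the box is lengthened by a face: the facet orthogonal to it is unchanged, every
    other facet gains a facet of the attached face. *)
Lemma surfS m l d : l <= d -> surf m l.+1 d.+1 = surf m l d.+1 + surf m l d.
Proof.
rewrite /surf /= => ld.
have [->|l0] := posnP l.
  case: d {ld} => [|d]; first by rewrite /box /=.
  by rewrite /= (boxMl m (leq0n d)) boxMSl; nia.
case: l l0 ld => // l _; case: d => // d ld /=.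
rewrite !boxMSl boxMl // subSS.
have [e|ld'] : l = d \/ l < d by lia.
  by rewrite e !subnn subSnn; nia.
case: d ld' {ld} => // d ld.
rewrite !boxMSl (boxMl m (ld : l <= d)).
rewrite (_ : d.+3 - l.+1 = (d.+2 - l.+1).+1); last by lia.
nia.
Qed.

(** At [r = box m l d] the greedy choice jumps to the next pseudo-cube; [surfS] shows that the value
    is the same. *)
Lemma del_box_add m l d r : 0 < m -> l <= d -> r <= box m l d ->
  del d.+1 (box m l d.+1 + r) = surf m l d.+1 + del d r.
Proof.
move=> m0 ld; rewrite leq_eqVlt => /orP[/eqP ->|]; last exact: del_box_add_lt.
by rewrite -boxS // !del_boxn // surfS.
Qed.

Lemma del_boxS_add m l d r : 0 < m -> l <= d -> r <= box m l d ->
  del d.+1 (box m l.+1 d.+1 + r) = surf m l.+1 d.+1 + del d r.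
Proof.
move=> m0 ld rb; move: (ld); rewrite leq_eqVlt => /orP[/eqP e|ld']; last first.
  apply: del_box_add => //; apply: leq_trans rb _.
  exact: ltnW (ltn_boxS _ _).
subst l; have e : box m d.+1 d.+1 = box m.+1 0 d.+1 by rewrite box0 box_full.
rewrite -del_boxn // e del_box_add //; first by rewrite -(@del_boxn m.+1 0).
by rewrite box0 -box_full.
Qed.

(** * Subadditivity and concavity *)

Definition subadditive (f : nat -> nat) : Prop :=
  forall a b, f (a + b) <= f a + f b.

(** Concavity only for spreads that push one of the two arguments up to the end point [A]. *)
Definition end_concave (f : nat -> nat) (A : nat) : Prop :=
  forall a b, a <= A -> b <= A -> A <= a + b ->
    f A + f (a + b - A) <= f a + f b.

Lemma del1 d : del d 1 = d.
Proof.
case: d => // d; have e : 1 = box 1 0 d.+1 by rewrite box0 exp1n.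
rewrite {1}e del_boxn // /surf mul0n add0n subn0 /=.
by rewrite box0 exp1n muln1.
Qed.

Section DimensionStep.

Variable d : nat.
Hypothesis sub : subadditive (del d).
Hypothesis conc :
  forall m l, 0 < m -> l <= d -> end_concave (del d) (box m l d).

(** Either [r] and [s] fit on one face, by subadditivity in dimension [d], or they complete it and
    the excess starts a new one, by end-concavity. *)
Lemma del_add_piece m l r s : 0 < m -> l <= d ->
  r <= box m l d -> s <= box m l d ->
  del d.+1 (box m l d.+1 + r + s) <= del d.+1 (box m l d.+1 + r) + del d s.
Proof.
move=> m0 ld rB sB; rewrite (del_box_add m0 ld rB).
have [h|h] := leqP (r + s) (box m l d).
  by rewrite -addnA del_box_add // -addnA leq_add2l.
have -> : box m l d.+1 + r + s = box m l.+1 d.+1 + (r + s - box m l d).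
  by rewrite boxS //; lia.
rewrite del_boxS_add //; last by lia.
rewrite surfS // -(@del_boxn m l d) //.
by have := conc m0 ld rB sB (ltnW h); lia.
Qed.

(** Induction on the smaller summand [b]: its pseudo-cube is added by induction, after which its
    remainder fits on a face of the result. *)
Lemma del_subadditive_step : subadditive (del d.+1).
Proof.
suff H b : forall a, b <= a -> del d.+1 (a + b) <= del d.+1 a + del d.+1 b.
  by move=> a b; case/orP: (leq_total b a) => h; [|rewrite addnC [leqRHS]addnC]; exact: H.
have [k] := ubnP b; elim: k b => // k IH b bk a ba.
have [->|b0] := posnP b; first by rewrite del_n0 !addn0.
have a0 : 0 < a by lia.
have [m [l [r [m0 ld rB ea]]]] := box_decomp d a0.
have [b1|b1] := leqP b 1.
  have -> : b = 1 by lia.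
  rewrite ea; apply: leq_trans (del_add_piece m0 ld (ltnW rB) _) _.
    exact: box_gt0.
  by rewrite !del1 leq_add2l.
have [m' [l' [s [m0' ld' /andP[s0 sB'] eb]]]] := box_decomp_pos d b1.
rewrite {2}eb (del_box_add m0' ld' sB') -del_boxn //; last by lia.
set b0' := box m' l' d.+1 in eb *.
have h1 : del d.+1 (a + b0') <= del d.+1 a + del d.+1 b0' by apply: IH; lia.
have a1 : 0 < a + b0' by lia.
have [m1 [l1 [r1 [m10 ld1 rB1 ea1]]]] := box_decomp d a1.
have sB1 : s <= box m1 l1 d.
  apply: leq_trans sB' _.
  by apply: leq_face => //; rewrite boxS // -/b0'; lia.
have := del_add_piece m10 ld1 (ltnW rB1) sB1.
rewrite -ea1 eb addnA; lia.
Qed.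

Lemma del_end_concave_boxS m l : 0 < m -> l <= d ->
  end_concave (del d.+1) (box m l d.+1) ->
  end_concave (del d.+1) (box m l.+1 d.+1).
Proof.
move=> m0 ld IHA; set A := box m l d.+1 in IHA; set B := box m l d.
have eA : box m l.+1 d.+1 = A + B by rewrite boxS.
have delA x : x <= B -> del d.+1 (A + x) = del d.+1 A + del d x.
  by move=> xB; rewrite del_box_add // del_boxn // ltnW.
rewrite eA.
(* [b <= A]: move the last layer of [b] onto the layer [x] of [A + x]. *)
have low b x : b <= A -> x <= B -> B <= b + x ->
    del d.+1 (A + B) + del d.+1 (b + x - B) <= del d.+1 (A + x) + del d.+1 b.
  have [k] := ubnP b; elim: k b x => // k IH b x bk bA xB Bbx.
  have [b1|b1] := leqP b 1.
    have [xe|xB1] := eqVneq x B; first by rewrite xe addnK.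
    have [b0 xe] : b = 1 /\ B = x + 1 by lia.
    rewrite b0 xe (_ : 1 + x - (x + 1) = 0); last by lia.
    by rewrite del_n0 addn0 addnA; apply: del_subadditive_step.
  have [m' [l' [s [m0' ld' /andP[s0 sB'] eb]]]] := box_decomp_pos d b1.
  set b0 := box m' l' d.+1 in eb.
  have delb t : t <= s -> del d.+1 (b0 + t) = del d.+1 b0 + del d t.
    move=> ts; rewrite del_box_add //; last by lia.
    by rewrite del_boxn //; lia.
  have sB : s <= B.
    apply: leq_trans sB' (leq_face _ _ _ _ _) => //.
    rewrite -/b0 eA; have := box_gt0 l d m0; rewrite -/B; lia.
  rewrite {2}eb delb //.
  (* Either all of [s] joins the layer and the induction continues with [b0], or end-concavity at
     [B] fills the layer and leaves the rest on [b0]. *)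
  have [h|h] := leqP (x + s) B.
    have := IH b0 (x + s); rewrite (_ : b0 + (x + s) - B = b + x - B); last by lia.
    rewrite !delA //; have := sub x s; lia.
  have := @conc m l m0 ld x s xB sB (ltnW h); rewrite -/B.
  rewrite (_ : b + x - B = b0 + (x + s - B)); last by lia.
  rewrite !delA // delb; lia.
(* Two summands up to [A] are first spread to reach [A], then [low] applies with [x = 0]. If one
   exceeds [A], [low] applies directly. If both do, their excesses merge into one, or into a full
   face and a rest. *)
move=> a b.
have [bA|bA] := leqP b A => aAB bAB ABab.
  have [aA|aA] := leqP a A.
    have h1 := IHA a b aA bA; have h2 := low (a + b - A) 0.
    move: h2; rewrite !addn0 (_ : a + b - A - B = a + b - (A + B)); last by lia.
    lia.
  have := low b (a - A); rewrite subnKC; last by lia.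
  rewrite (_ : b + (a - A) - B = a + b - (A + B)); last by lia.
  lia.
have [aA|aA] := leqP a A.
  have := low a (b - A); rewrite subnKC; last by lia.
  rewrite (_ : a + (b - A) - B = a + b - (A + B)); last by lia.
  lia.
have [x [y [ea eb]]] : exists x y, a = A + x /\ b = A + y.
  by exists (a - A), (b - A); lia.
have xB : x <= B by lia.
have yB : y <= B by lia.
rewrite ea eb !delA //.
have [h|h] := leqP (x + y) B.
  have := low A (x + y) (leqnn _) h.
  rewrite (_ : A + (x + y) - B = A + x + (A + y) - (A + B)); last by lia.
  rewrite !delA //; have := sub x y; lia.
have := @conc m l m0 ld x y xB yB (ltnW h); rewrite -/B.
rewrite (_ : A + x + (A + y) - (A + B) = A + (x + y - B)); last by lia.
by rewrite !delA //; lia.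
Qed.

Lemma del_end_concave_step m l : 0 < m -> l <= d.+1 ->
  end_concave (del d.+1) (box m l d.+1).
Proof.
move=> m0 ld.
have side k : 0 < k -> end_concave (del d.+1) (box k 0 d.+1) ->
    forall j, j <= d.+1 -> end_concave (del d.+1) (box k j d.+1).
  move=> k0 h0; elim=> // j IH jd.
  by apply: del_end_concave_boxS => //; apply: IH; lia.
(* The pseudo-cubes form one chain starting at [1]: with all directions long, side [m] becomes the
   cube of side [m.+1]. *)
apply: (side) => //; elim: m m0 => // -[|m] IH _.
  rewrite box0 exp1n => a b a1 b1 ab.
  have [->|->] : a = 1 \/ b = 1 by lia.
    by rewrite addKn.
  by rewrite addnK addnC.
rewrite box0 -box_full; apply: side => //; exact: IH.
Qed.

End DimensionStep.

Lemma del_subadditive_concave d : subadditive (del d) /\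
  forall m l, 0 < m -> l <= d -> end_concave (del d) (box m l d).
Proof.
elim: d => [|d [sub conc]]; first by [].
by split; [apply: del_subadditive_step|apply: del_end_concave_step].
Qed.

Lemma del_subadditive d : subadditive (del d).
Proof. by case: (del_subadditive_concave d). Qed.

Lemma del_end_concave d m l : 0 < m -> l <= d ->
  end_concave (del d) (box m l d).
Proof. by case: (del_subadditive_concave d) => _; apply. Qed.

(** * The layer inequality *)

(** A layer that fits on a face of the largest pseudo-cube below [N] is handled by [del_add_piece].
    For a larger one the hypotheses force that pseudo-cube to have side [M]. *)
Lemma del_add_layer d M N c : 0 < M -> M * c <= N -> N + c <= M.+1 ^ d.+1 ->
  del d.+1 (N + c) <= del d.+1 N + del d c.
Proof.
elim: d N c => [|d IH] N c M0 McN NcM.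
all: have [->|c0] := posnP c; first by rewrite del_n0 !addn0.
all: have N0 : 0 < N by nia.
  have [m [l [R [m0 ld rB eN]]]] := box_decomp 0 N0.
  have l0 : l = 0 by lia.
  have c1 : c <= box m l 0 by rewrite l0 box0 expn0; rewrite expn1 in NcM; nia.
  rewrite eN; apply: (del_add_piece (@del_subadditive 0) (@del_end_concave 0)) => //.
  exact: ltnW.
have [m [l [R [m0 ld RB eN]]]] := box_decomp d.+1 N0.
have [cB|cB] := leqP c (box m l d.+1).
  rewrite eN.
  apply: (del_add_piece (@del_subadditive _) (@del_end_concave _)) => //.
  exact: ltnW.
(* The layer exceeds the face it is put on; the excess is treated one
   dimension lower. *)
have eM : m = M.
  have : m ^ d.+2 < M.+1 ^ d.+2.
    have := leq_cube_box m0 (leqW ld); lia.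
  rewrite ltn_exp2r // ltnS leq_eqVlt => /orP[/eqP//|mM].
  by move: eN; rewrite boxMl //; nia.
subst m.
have ld1 : l <= d.
  move: ld; rewrite leq_eqVlt => /orP[/eqP el|//].
  have := boxS M (leqnn d.+1); rewrite box_full; subst l; lia.
have eB := boxMl M ld1; have eN' := boxMl M ld.
have [e ec] : exists e, c = box M l d.+1 + e by exists (c - box M l d.+1); lia.
(* Cancelling [M * box M l d.+1] in [M * c <= N] gives the same hypothesis for [R] and [e], to which
   the induction applies. *)
have eR : M * e <= R by rewrite ec in McN; lia.
have eb : e <= box M l d by nia.
have bS := boxS M ld1.
rewrite {2}ec eN (del_box_add M0 ld (ltnW RB)) (del_box_add M0 ld1 eb).
rewrite (_ : _ + c = box M l.+1 d.+2 + (R + e)); last by rewrite boxS //; lia.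
rewrite del_box_add //; last by lia.
rewrite surfS //.
have := IH R e M0 eR; have := @leq_box_cube M l.+1 d.+1 M0 ld1; lia.
Qed.

Lemma del1_gt0 n : 0 < n -> del 1 n = 1.
Proof.
move=> n0; have {1}-> : n = box n 0 1 by rewrite box0 expn1.
by rewrite del_boxn // /surf /= box0 expn0.
Qed.

Lemma leq_sum_size_max (s : seq nat) :
  \sum_(a <- s) a <= size s * \max_(a <- s) a.
Proof.
elim: s => [|x s IH]; first by rewrite big_nil.
by rewrite !big_cons /= mulSn; nia.
Qed.

Lemma perm_eq_min (s : seq nat) : 0 < size s ->
  exists (x : nat) (t : seq nat), perm_eq s (x :: t) /\ all (leq x) t.
Proof.
elim: s => // y u IH _; have [u0|/IH[x [t [pe xt]]]] := posnP (size u).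
  by exists y, [::]; rewrite (size0nil u0).
have [yx|xy] := leqP y x.
  exists y, u; split=> //; rewrite (perm_all _ pe) /= yx /=.
  by apply/allP => z /(allP xt) /(leq_trans yx).
exists x, (y :: t); rewrite /= xt ltnW //; split=> //.
apply: (@perm_trans _ (y :: x :: t)); first by rewrite perm_cons.
by apply/permPl; apply: (perm_catCA [:: y] [:: x] t).
Qed.

(* [s] lists the sizes of the parallel layers of a set. *)
Lemma del_sum_layers d (s : seq nat) :
  del d.+1 (\sum_(a <- s) a) <= \sum_(a <- s) del d a + \max_(a <- s) a.
Proof.
elim: d s => [|d IHd] s.
  have [->|n0] := posnP (\sum_(a <- s) a); first by rewrite del_n0.
  rewrite del1_gt0 //; have := leq_sum_size_max s; nia.
(* [size s] enters the measure because the smallest layer that is removed may be empty. *)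
have [k] := ubnP (\sum_(a <- s) a + size s); elim: k s => // k IH s sk.
set n := \sum_(a <- s) a in sk *; set A := \max_(a <- s) a.
have nA : n <= size s * A by exact: leq_sum_size_max.
have [s0|s0] := posnP (size s).
  by move: nA; rewrite s0 leqn0 => /eqP ->.
have memA (a : nat) : a \in s -> a <= A by move=> /leq_bigmax_seq; apply.
have [nk|nk] := leqP n (size s ^ d.+2).
  have [x [t [pe xmin]]] := perm_eq_min s0.
  have en : n = x + \sum_(a <- t) a by rewrite /n (perm_big _ pe) big_cons.
  have eS : \sum_(a <- s) del d.+1 a = del d.+1 x + \sum_(a <- t) del d.+1 a.
    by rewrite (perm_big _ pe) big_cons.
  have eA : A = maxn x (\max_(a <- t) a) by rewrite /A (perm_big _ pe) big_cons.
  have sz : size s = (size t).+1 by rewrite (perm_size pe).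
  have tx : size t * x <= \sum_(a <- t) a.
    elim: (t) xmin => //= y u IHu /andP[xy /IHu]; rewrite big_cons mulSn; lia.
  rewrite eS; have [t0|t0] := posnP (size t).
    move: en nk eA; rewrite sz t0 exp1n (size0nil t0) !big_nil => -> x1 ->.
    have [->|->] : x = 0 \/ x = 1 by lia.
      by rewrite !del_n0.
    by rewrite !del1; lia.
  (* The removed layer [x] is at most each of the others, so [M = size t] is admissible. *)
  have := IH t; have := @del_add_layer d.+1 (size t) (\sum_(a <- t) a) x t0 tx.
  rewrite -sz addnC -en => /(_ nk) h1 h2.
  have {}h2 := h2 ltac:(lia); lia.
have A1 : 1 < A.
  have : size s ^ 1 <= size s ^ d.+2 by rewrite leq_pexp2l.
  by rewrite expn1; nia.
have [m [l [r [m0 ld /andP[r0 rB] eA]]]] := box_decomp_pos d A1.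
set D := box m l d.+1 in eA; have eD : D = m * box m l d by rewrite /D boxMl.
have Am : A <= m.+1 ^ d.+1.
  by apply: leq_trans (@leq_box_cube m l.+1 d.+1 m0 ld); rewrite boxS // -/D; lia.
have km : size s <= m.
  have : size s ^ d.+1 < m.+1 ^ d.+1.
    apply: leq_trans Am; rewrite -(ltn_pmul2l s0) -expnS; lia.
  by rewrite ltn_exp2r.
pose s1 := [seq minn a D | a <- s]; pose s2 := [seq a - D | a <- s].
have e12 : n = \sum_(a <- s1) a + \sum_(a <- s2) a.
  by rewrite !big_map -big_split; apply: eq_bigr => a _ /=; lia.
have edel : \sum_(a <- s) del d.+1 a =
    \sum_(a <- s1) del d.+1 a + \sum_(a <- s2) del d a.
  rewrite !big_map -big_split; apply: eq_big_seq => a /memA aA /=.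
  have [aD|aD] := leqP a D.
    by rewrite (eqP aD) del_n0 addn0.
  have {1}-> : a = D + (a - D) by lia.
  by rewrite del_box_add ?del_boxn //; lia.
have max1 : \max_(a <- s1) a <= D.
  by rewrite big_map; apply/bigmax_leqP_seq => a _ _; exact: geq_minr.
have max2 : \max_(a <- s2) a <= r.
  by rewrite big_map; apply/bigmax_leqP_seq => a /memA; lia.
have s2_gt0 : 0 < \sum_(a <- s2) a.
  suff : A <= D + \sum_(a <- s2) a by lia.
  apply/bigmax_leqP_seq => a as_ _.
  by rewrite big_map (big_rem a) //=; lia.
(* Here [M = m]: each excess is at most a face [box m l d], and [D] consists of [m] such faces. *)
have ms : m * \sum_(a <- s2) a <= \sum_(a <- s1) a.
  rewrite !big_map big_distrr; rewrite !big_seq.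
  apply: leq_sum => b /memA bA /=.
  have [bD|bD] := leqP b D; first by rewrite (eqP bD) muln0.
  rewrite eD leq_mul2l; lia.
have := @del_add_layer d.+1 m _ _ m0 ms; rewrite -e12.
have nm : n <= m.+1 ^ d.+2 by rewrite expnS; nia.
have := IH s1; rewrite size_map; have := IHd s2; lia.
Qed.

(** * Tops of sets in the grid *)

Local Open Scope fset_scope.
Local Open Scope nat_scope.

Lemma card_fset_filter (K : choiceType) (S : {fset K}) (P : pred K) :
  #|` [fset x in S | P x]| = \sum_(x <- S) P x.
Proof.
rewrite card_fset_sum1 -big_fset_condE /= big_mkcond /=.
by apply: eq_bigr => x _; case: (P x).
Qed.

Lemma sum_card_fibers (K T : choiceType) (h : K -> T) (S : {fset K})
    (V : {fset T}) : (forall x, x \in S -> h x \in V) ->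
  \sum_(v <- V) #|` [fset x in S | h x == v]| = #|` S|.
Proof.
move=> hV; under eq_bigr do rewrite card_fset_filter.
rewrite exchange_big card_fset_sum1 /=; apply: eq_big_seq => x xS.
rewrite (eq_bigr (fun v => if v == h x then 1 else 0)); last first.
  by move=> v _; rewrite eq_sym; case: eqP.
by rewrite -big_mkcond sum1_count count_uniq_mem ?fset_uniq // hV.
Qed.

Section Grid.

Variable d : nat.
Implicit Types (i j : 'I_d) (x y p : grid d) (S C : {fset grid d}).

Definition upd i (v : int) x : grid d := [ffun j => if j == i then v else x j].

Definition up i x : grid d := upd i (x i + 1)%R x.

Definition tops i S : {fset grid d} := [fset x in S | up i x \notin S].

Lemma updE i v x j : upd i v x j = if j == i then v else x j.
Proof. by rewrite ffunE. Qed.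

Lemma upE i x j : up i x j = (x j + (j == i)%:R)%R.
Proof. by rewrite updE; case: eqP => [->|_] //; rewrite addr0. Qed.

Lemma upd_upd i u v x : upd i u (upd i v x) = upd i u x.
Proof. by apply/ffunP => j; rewrite !updE; case: eqP. Qed.

Lemma upd_id i x : upd i (x i) x = x.
Proof. by apply/ffunP => j; rewrite updE; case: eqP => // ->. Qed.

(** On the line in direction [i] through a point of the layer, the highest point of [S] is a top and
    determines that point. *)
Lemma leq_layer_tops i v S :
  #|` [fset x in S | x i == v]| <= #|` tops i S|.
Proof.
apply: (@leq_trans #|` [fset upd i v y | y in tops i S]|); last first.
  exact: leq_imfset_card.
apply: fsubset_leq_card; apply/fsubsetP => x; rewrite !inE /= => /andP[xS /eqP xv].
pose L := [fset y in S | upd i v y == x].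
have xL : x \in L by rewrite !inE /= xS -xv upd_id eqxx.
have [y _ ymax] := @arg_maxP _ int L [` xL] xpredT (fun y : L => (val y : grid d) i) isT.
have := valP y; rewrite !inE /= => /andP[yS /eqP yx].
apply/imfsetP; exists (val y) => //=; rewrite !inE yS /=.
apply/negP => uS; have uL : up i (val y) \in L by rewrite !inE /= uS upd_upd yx eqxx.
by have := ymax [` uL] isT; rewrite /= upE eqxx gerDl.
Qed.

(** Lower-dimensional layers stay in the same grid, with all coordinates from [k] on constant; the
    induction cuts along the last free coordinate. *)
Lemma del_leq_tops k S : k <= d ->
  (forall x y i, x \in S -> y \in S -> k <= i -> x i = y i) ->
  del k #|` S| <= \sum_(i < d | i < k) #|` tops i S|.
Proof.
elim: k S => [|k IH] S kd Sk; first by [].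
pose i0 := Ordinal kd; pose V := [fset (x : grid d) i0 | x in S].
have SV x : x \in S -> x i0 \in V by move=> xS; apply: (in_imfset _ (fun x : grid d => x i0)).
pose L v := [fset x in S | x i0 == v].
pose s := [seq #|` L v| | v <- V].
have es : \sum_(a <- s) a = #|` S| by rewrite big_map sum_card_fibers.
have h1 : \max_(a <- s) a <= #|` tops i0 S|.
  by rewrite big_map; apply/bigmax_leqP_seq => v _ _; apply: leq_layer_tops.
have h2 : \sum_(a <- s) del k a <= \sum_(i < d | i < k) #|` tops i S|.
  (* A move in a direction [i < k] stays inside its layer, so the tops of [S] are those of the
     layers. *)
  have e i : i < k -> #|` tops i S| = \sum_(v <- V) #|` tops i (L v)|.
    move=> ik; rewrite -(@sum_card_fibers _ _ (fun x : grid d => x i0) _ V); last first.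
      by move=> x; rewrite !inE => /andP[/SV].
    apply: eq_bigr => v _; congr #|` _|; apply/fsetP => x; rewrite !inE /=.
    have -> : up i x i0 = x i0.
      rewrite upE (_ : (i0 == i) = false) ?addr0 //.
      by apply/eqP => e; move: ik; rewrite -e ltnn.
    by case: (x \in S) => //=; case: eqP; rewrite ?andbT ?andbF.
  rewrite (eq_bigr _ e) exchange_big big_map; apply: leq_sum => v _.
  apply: IH; first exact: ltnW.
  move=> x y i; rewrite !inE /= => /andP[xS /eqP xv] /andP[yS /eqP yv].
  rewrite leq_eqVlt => /orP[/eqP ki|]; last exact: Sk.
  by have -> : i = i0 by [apply: val_inj]; rewrite xv yv.
rewrite -es; apply: leq_trans (del_sum_layers _ _) _.
rewrite (bigD1 i0) //= addnC leq_add //; apply: leq_trans h2 _.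
rewrite [leqRHS](eq_bigl (fun i : 'I_d => i < k)) // => i.
by rewrite -val_eqE /=; lia.
Qed.

Lemma grid_adjP x y :
  reflect (exists i, y = up i x \/ x = up i y) (grid_adj x y).
Proof.
apply: (iffP eqP) => [s1|[i e]].
  have [i xi|all0] := pickP (fun i => x i != y i); last first.
    by move: s1; rewrite big1 // => i _; have := all0 i; case: eqP => // ->; rewrite subrr.
  move: s1; rewrite (bigD1 i) //= => s1.
  have r0 : (0 <= \sum_(j < d | j != i) `|x j - y j|)%R by apply: sumr_ge0.
  have d1 : (1 <= `|x i - y i|)%R by move: xi; rewrite -subr_eq0 -normr_gt0; lia.
  have rest : (\sum_(j < d | j != i) `|x j - y j| = 0)%R.
    apply/eqP; rewrite eq_le r0 andbT -(lerD2l `|x i - y i|%R) s1 addr0.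
    exact: d1.
  have xy j : j != i -> x j = y j.
    move=> ji; apply/eqP; rewrite -subr_eq0 -normr_eq0; apply/eqP.
    exact: (psumr_eq0P _ rest).
  move: s1; rewrite rest addr0 => s1.
  exists i; have [e|e] : (y i = x i + 1 \/ x i = y i + 1)%R.
    move/eqP: s1; rewrite eqr_norml andbT => /orP[/eqP e|/eqP e]; [right|left].
      by rewrite -e addrC subrK.
    by rewrite -[1%R]opprK -e opprB addrC subrK.
    by left; apply/ffunP => j; rewrite updE; case: eqP => [->|/eqP /xy].
  by right; apply/ffunP => j; rewrite updE; case: eqP => [->|/eqP /xy].
rewrite (bigD1 i) //= big1 ?addr0 => [|j /negbTE ji].
  case: e => ->; rewrite upE eqxx.
    by rewrite opprD addNKr normrN1.
  by rewrite addrAC subrr add0r normr1.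
by case: e => ->; rewrite upE ji addr0 subrr normr0.
Qed.

Lemma up_neq i x : up i x != x.
Proof. by apply/eqP => /ffunP/(_ i); rewrite upE eqxx; lia. Qed.

Lemma up_inj_dir i j x : up i x = up j x -> i = j.
Proof. by move=> /ffunP/(_ i); rewrite !upE eqxx; case: eqP => //; lia. Qed.

Lemma up_up_neq i j x : up i (up j x) != x.
Proof. by apply/eqP => /ffunP/(_ i); rewrite !upE eqxx; case: eqP; lia. Qed.

(** Each edge has one direction and one lower endpoint; [P] collects these pairs and [g] maps them
    bijectively to the edges. *)
Lemma num_edgesE S :
  num_edges S = \sum_(i < d) #|` [fset x in S | up i x \in S]|.
Proof.
pose P := [set q : 'I_d * S | up q.1 (val q.2) \in S].
pose g (q : 'I_d * S) := [set q.2; insubd q.2 (up q.1 (val q.2))].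
have insE q : q \in P -> val (insubd q.2 (up q.1 (val q.2))) = up q.1 (val q.2).
  by rewrite inE => h; rewrite val_insubd h.
have ginj : {in P &, injective g}.
  move=> [i x] [j y] iP jP gxy.
  have ux := insE _ iP; have uy := insE _ jP; rewrite /= in ux uy.
  have xg : x \in g (j, y) by rewrite -gxy set21.
  have yg : y \in g (i, x) by rewrite gxy set21.
  have exy : x = y.
    move: xg yg; rewrite !inE /= => /orP[/eqP//|/eqP ex] /orP[/eqP//|/eqP ey].
    have vy : up i (up j (val y)) = val y by rewrite -uy -ex -ux -ey.
    by have := up_up_neq i j (val y); rewrite vy eqxx.
  subst y; have : insubd x (up i (val x)) \in g (j, x) by rewrite -gxy set22.
  rewrite !inE /= => /orP[/eqP e|/eqP e].
    by have := up_neq i (val x); rewrite -ux e eqxx.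
  by congr (_, _); apply: (@up_inj_dir i j (val x)); rewrite -ux e uy.
have -> : num_edges S = #|P|.
  rewrite -(card_in_imset ginj); apply: eq_card => e; rewrite inE.
  apply/existsP/imsetP => [[x /existsP[y /andP[/grid_adjP[i xy] /eqP ->]]]|[q qP ->]].
    have w (u v : S) : val v = up i (val u) -> (i, u) \in P /\ g (i, u) = [set u; v].
      move=> uv; have uP : (i, u) \in P by rewrite inE /= -uv; exact: valP.
      by split=> //; congr [set _; _]; apply: val_inj; rewrite insE.
    by case: xy => /w[uP ge]; [exists (i, x)|exists (i, y); rewrite // setUC].
  exists q.2; apply/existsP; exists (insubd q.2 (up q.1 (val q.2))).
  by rewrite eqxx andbT; apply/grid_adjP; exists q.1; left; rewrite insE.
transitivity (\sum_(i < d) \sum_(x : S) (up i (val x) \in S)).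
  rewrite pair_big /= -sum1_card big_mkcond /=; apply: eq_bigr => q _.
  by rewrite inE; case: ifP.
by apply: eq_bigr => i _; rewrite card_fset_filter big_seq_fsetE.
Qed.

Lemma num_edges_tops S : num_edges S + \sum_(i < d) #|` tops i S| = d * #|` S|.
Proof.
rewrite num_edgesE -big_split /=; transitivity (\sum_(i < d) #|` S|); last first.
  by rewrite sum_nat_const card_ord.
apply: eq_bigr => i _; rewrite !card_fset_filter -big_split card_fset_sum1 /=.
by apply: eq_bigr => x _; case: (_ \in S).
Qed.

Lemma del_num_edges_le S : del d #|` S| + num_edges S <= d * #|` S|.
Proof.
rewrite -num_edges_tops addnC leq_add2l.
have -> : \sum_(i < d) #|` tops i S| = \sum_(i < d | i < d) #|` tops i S|.
  by apply: eq_bigl => i; rewrite ltn_ord.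
by apply: del_leq_tops => // x y i _ _; rewrite leqNgt ltn_ord.
Qed.

Definition Box p (b : 'I_d -> nat) : {fset grid d} :=
  [fset ([ffun i => p i + (f i : nat)%:Z]%R : grid d)
    | f : {dffun forall i, 'I_(b i)} in predT].

Lemma in_Box p b x :
  x \in Box p b = [forall i, (p i <= x i < p i + (b i)%:Z)%R].
Proof.
apply/imfsetP/forallP => /= [[f _ ->] i|h].
  by rewrite ffunE; have := ltn_ord (f i); lia.
have /fin_all_exists[f fE] i : exists k : 'I_(b i), (x i = p i + (k : nat)%:Z)%R.
  have /andP[pi xi] := h i; have lt : absz (x i - p i)%R < b i.
    by rewrite -ltz_nat gez0_abs ?subr_ge0 // ltrBlDl.
  exists (Ordinal lt); rewrite /= gez0_abs ?subr_ge0; first by rewrite addrC subrK.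
  exact: pi.
exists [ffun i => f i] => //; apply/ffunP => i.
by rewrite !ffunE fE.
Qed.

Lemma card_Box p b : #|` Box p b| = \prod_(i < d) b i.
Proof.
rewrite card_imfset /=; last first.
  move=> f g /ffunP fg; apply/ffunP => i; have := fg i; rewrite !ffunE.
  by move=> e; apply: val_inj; move: e => /=; lia.
rewrite -cardE card_dep_ffun foldrE big_map big_enum /=.
by apply: eq_bigr => i _; rewrite card_ord.
Qed.

Lemma Box_sub p b b' : (forall i, b i <= b' i) -> Box p b `<=` Box p b'.
Proof.
move=> bb; apply/fsubsetP => x; rewrite !in_Box => /forallP h.
by apply/forallP => i; have := h i; have := bb i; lia.
Qed.

(* Side lengths of a pseudo-cube spanned by the directions in [T], the long
   ones being those in [U]. *)
Definition sides m (U T : {set 'I_d}) i : nat :=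
  if i \in U then m.+1 else if i \in T then m else 1.

Lemma card_Box_sides p m (U T : {set 'I_d}) : U \subset T ->
  #|` Box p (sides m U T)| = box m #|U| #|T|.
Proof.
move=> UT; rewrite card_Box (bigID (mem U)) /=; congr (_ * _).
  by rewrite -prod_nat_const; apply: eq_bigr => i; rewrite /sides => ->.
rewrite (bigID (mem T)) /= [X in _ * X]big1 ?muln1; last first.
  by move=> i; rewrite /sides => /andP[/negbTE -> /negbTE ->].
have -> : #|T| - #|U| = #|T :\: U| by rewrite cardsD (setIidPr UT).
rewrite -prod_nat_const; apply: eq_big => i.
  by rewrite inE.
by rewrite /sides => /andP[/negbTE -> ->].
Qed.

End Grid.

(** * Optimal sets *)

Section Construction.

Variable d : nat.
Implicit Types (i j : 'I_d) (x y p : grid d) (S C : {fset grid d}).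
Implicit Types (T U : {set 'I_d}).

Lemma exists_subset_card T l : l < #|T| ->
  exists U i, [/\ U \subset T, i \in T, i \notin U & #|U| = l].
Proof.
move=> lT; pose U := [set i in take l (enum T)].
have cU : #|U| = l.
  rewrite cardsE (card_uniqP _) ?take_uniq ?enum_uniq // size_takel //.
  by rewrite -cardE ltnW.
have UT : U \subset T.
  by apply/subsetP => i; rewrite inE => /mem_take; rewrite mem_enum.
have /card_gt0P[i] : 0 < #|T :\: U|.
  by rewrite cardsD (setIidPr UT) cU subn_gt0.
by rewrite inE => /andP[iU iT]; exists U, i.
Qed.

(* Cutting the cube [U, m] along a box of shape [m0, l0] with a remainder [r]:
   the directions of the inner box and the direction in which the remainder
   sticks out can be chosen so that everything stays inside. *)
Lemma exists_inner_sides m T U k m0 l0 r : 0 < m -> 0 < m0 -> U \subset T ->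
  #|T| = k.+1 -> l0 <= k -> box m0 l0 k.+1 + r <= box m #|U| k.+1 ->
  exists U0 i, [/\ U0 \subset T, i \in T :\: U0, #|U0| = l0,
    forall j, sides m0 U0 T j <= sides m U T j &
    0 < r -> forall j, sides m0 (i |: U0) T j <= sides m U T j].
Proof.
move=> mp m0p UT cT l0k le; have Uk : #|U| <= k.+1 by rewrite -cT subset_leq_card.
have subU j U1 : U1 \subset T -> j \in U1 -> j \in T by move=> /subsetP; apply.
have [mm|mm|e] := ltngtP m0 m.
- have lT : l0 < #|T| by rewrite cT.
  have [U0 [i [UT0 iT iU cU]]] := exists_subset_card lT.
  have fit (U1 : {set 'I_d}) j : U1 \subset T -> sides m0 U1 T j <= sides m U T j.
    move=> U1T; rewrite /sides.
    have [jU1|_] := boolP (j \in U1); first by rewrite (subU j U1) //; case: ifP; lia.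
    by case: ifP => jU; case: ifP; lia.
  exists U0, i; split=> //.
  + by rewrite inE iU.
  + by move=> j; apply: fit.
  by move=> _ j; apply: fit; rewrite subUset sub1set iT.
(* [m0 > m] forces the inner box to be the whole outer box, a cube of side [m.+1], and [r = 0]. *)
- have c1 := leq_box_cube mp Uk; have c2 := leq_cube_box m0p (leqW l0k).
  have c3 : m.+1 ^ k.+1 <= m0 ^ k.+1 by rewrite leq_exp2r.
  have r0 : r = 0 by lia.
  have eU : #|U| = k.+1.
    by apply/eqP; rewrite eqn_leq Uk leqNgt; apply/negP => /(ltn_box_cube mp); lia.
  have em : m0 = m.+1.
    apply/eqP; rewrite eqn_leq mm andbT -(@leq_exp2r _ _ k.+1) //; lia.
  have el : l0 = 0.
    case: l0 l0k {c2} le => // l0 l0k le; have := @ltn_box m0 0 l0.+1 k.+1 m0p isT (leqW l0k).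
    by rewrite box0; lia.
  have TU : U = T by apply/eqP; rewrite eqEcard UT eU cT /=.
  have /card_gt0P[i iT] : 0 < #|T| by rewrite cT.
  exists set0, i; split; rewrite ?sub0set ?inE ?iT ?cards0 ?el // ?r0 // => j.
  by rewrite /sides inE TU em; case: ifP.
subst m0; have [ll|ll|e] := ltngtP l0 #|U|.
- have [U0 [i [UU0 iU iU0 cU]]] := @exists_subset_card U l0 ll.
  have fit (U1 : {set 'I_d}) j : U1 \subset U -> sides m U1 T j <= sides m U T j.
    move=> /subsetP U1U; rewrite /sides.
    have [jU1|_] := boolP (j \in U1); first by rewrite U1U.
    by case: ifP => jU; case: ifP; lia.
  exists U0, i; split=> //.
  + exact: subset_trans UU0 UT.
  + by rewrite inE iU0 (subsetP UT).
  + by move=> j; apply: fit.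
  by move=> _ j; apply: fit; rewrite subUset sub1set iU.
- by have := @ltn_box m _ _ k.+1 mp ll (leqW l0k); lia.
have /card_gt0P[i iT] : 0 < #|T :\: U|.
  by rewrite cardsD (setIidPr UT) cT -e; lia.
exists U, i; split=> // r0; move: le; rewrite -e; lia.
Qed.

Lemma tops_Box j p b : 0 < b j ->
  tops j (Box p b) `<=`
  Box (upd j (p j + (b j)%:Z - 1)%R p) (fun i => if i == j then 1 else b i).
Proof.
move=> bj; apply/fsubsetP => x; rewrite !inE /= !in_Box.
move=> /andP[/forallP xB /forallPn[i]].
rewrite upE; have [->|ij] := eqVneq i j; last by rewrite addr0 xB.
move=> h; apply/forallP => i'; rewrite updE; have := xB i'.
have [->|_] := eqVneq i' j; last by [].
by move: h; move: (p j) (x j) (b j) => u v c; lia.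
Qed.

Lemma sides_setD1 m U T j : j \in T ->
  sides m (U :\ j) (T :\ j) =1 (fun i => if i == j then 1 else sides m U T i).
Proof. by move=> jT i; rewrite /sides !inE; case: eqP. Qed.

Lemma card_tops_Box_sides j p m U T : 0 < m -> U \subset T -> j \in T ->
  #|` tops j (Box p (sides m U T))| <= box m #|U :\ j| #|T|.-1.
Proof.
move=> m0 UT jT; have sj : 0 < sides m U T j by rewrite /sides jT; case: ifP.
apply: leq_trans (fsubset_leq_card (tops_Box p sj)) _.
rewrite card_Box (eq_bigr _ (fun i _ => esym (sides_setD1 m U jT i))).
rewrite -(card_Box p) card_Box_sides ?setSD //.
by rewrite [#|T|](cardsD1 j) jT.
Qed.

(** Each point of [C] covers the point of the box beneath it, so projecting the tops onto the upper
    facet is injective. *)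
Lemma card_tops_attach i p m U T (C : {fset grid d}) :
  0 < m -> U \subset T -> i \in T :\: U ->
  C `<=` Box (upd i (p i + m%:Z)%R p) (sides m U (T :\ i)) ->
  #|` tops i (Box p (sides m U T) `|` C)| <= box m #|U| #|T|.-1.
Proof.
move=> m0 UT; rewrite inE => /andP[iU iT] /fsubsetP CB.
have eU : U :\ i = U by apply/setDidPl; rewrite disjoint_sym disjoints1.
have si : sides m U T i = m by rewrite /sides (negbTE iU) iT.
have -> : box m #|U| #|T|.-1 =
    #|` Box (upd i (p i + m%:Z - 1)%R p) (sides m U (T :\ i))|.
  rewrite card_Box_sides; first by rewrite [#|T|](cardsD1 i) iT.
  by rewrite -eU setSD.
set q := upd i (p i + m%:Z - 1)%R p; set B := Box p _.
have sE := sides_setD1 m U iT; rewrite eU in sE.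
have Ci x : x \in C -> x i = (p i + m%:Z)%R.
  move=> /CB; rewrite in_Box => /forallP/(_ i).
  by rewrite updE eqxx sE eqxx; lia.
have topB x : x \in tops i (B `|` C) -> x \notin C -> x i = q i /\ x \in Box q (sides m U (T :\ i)).
  rewrite !inE => xt xC; move: xt; rewrite (negbTE xC) orbF negb_or.
  move=> /andP[xB /andP[uB _]].
  have sp : 0 < sides m U T i by rewrite si.
  have /(fsubsetP (tops_Box p sp)) : x \in tops i B by rewrite !inE xB.
  rewrite si !in_Box -/q => /forallP xq; split; last first.
    by apply/forallP => j; rewrite sE; exact: xq.
  have := xq i; rewrite eqxx; move: (x i) (q i) => u w; lia.
have qi : q i = (p i + m%:Z - 1)%R by rewrite updE eqxx.
have Cq x : x \in C -> upd i (q i + 1)%R x = x.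
  by move=> /Ci xi; rewrite qi subrK -xi upd_id.
have inj : {in tops i (B `|` C) &, injective (upd i (q i))}.
  have lone x y : x \in tops i (B `|` C) -> x \notin C -> y \in C ->
      upd i (q i) x = upd i (q i) y -> False.
    move=> xt xC yC xy; have [xi _] := topB x xt xC.
    move: xt; rewrite !inE negb_or => /andP[_ /andP[_ /negP]]; apply.
    by rewrite /up xi -(upd_upd i _ (q i)) xy upd_upd Cq.
  move=> x y xt yt xy; have [xC|xC] := boolP (x \in C); have [yC|yC] := boolP (y \in C).
  - by rewrite -[x]Cq // -[y]Cq // -(upd_upd i _ (q i)) xy upd_upd.
  - by case: (lone y x).
  - by case: (lone x y).
  have [xi _] := topB x xt xC; have [yi _] := topB y yt yC.
  by rewrite -(upd_id i x) -(upd_id i y) xi yi.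
have <- := card_in_imfset imfset_key inj; apply: fsubset_leq_card.
apply/fsubsetP => _ /imfsetP[x /= xt ->].
have [xC|xC] := boolP (x \in C); last first.
  by have [xi xL] := topB x xt xC; rewrite -xi upd_id.
have := CB x xC; rewrite !in_Box => /forallP xB; apply/forallP => j.
have := xB j; rewrite !updE eqxx sE; case: eqP => // _ _.
by move: (p i + m%:Z - 1)%R => w; lia.
Qed.

(** Prescribing the surrounding box lets the induction place the remainder on a face of the inner
    box. *)
Lemma exists_tops_le k T U m p r : #|T| = k -> U \subset T -> 0 < m ->
  r <= box m #|U| k ->
  exists C, [/\ C `<=` Box p (sides m U T), #|` C| = r &
    \sum_(i in T) #|` tops i C| <= del k r].
Proof.
elim: k T U m p r => [|k IH] T U m p r cT UT m0 rB.
  have T0 : T = set0 by apply/eqP; rewrite -cards_eq0 cT.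
  have U0 : U = set0 by apply/eqP; rewrite -subset0 -T0.
  move: rB; rewrite U0 cards0 box0 expn0 => rB.
  have [->|->] : r = 0 \/ r = 1 by lia.
    by exists fset0; rewrite fsub0set cardfs0 T0 big_set0; split.
  exists (Box p (sides m set0 T)); split; first exact: fsubset_refl.
    by rewrite card_Box_sides ?sub0set // cards0 cT.
  by rewrite T0 big_set0.
have [->|r0] := posnP r.
  exists fset0; rewrite fsub0set cardfs0; split=> //.
  rewrite big1 // => i _; apply/eqP; rewrite cardfs_eq0; apply/eqP/fsetP => x.
  by rewrite !inE.
have [m' [l [r' [m'0 lk r'B er]]]] := box_decomp k r0.
have [|V [i [VT iTV cV fit fitS]]] := @exists_inner_sides m T U k m' l r' m0 m'0 UT cT lk.
  by rewrite -er.
move: (iTV); rewrite inE => /andP[iV iT].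
have cTi : #|T :\ i| = k by move: cT; rewrite (cardsD1 i) iT => -[].
have VTi : V \subset T :\ i by rewrite subsetD1 VT.
have [|C [CB cC tC]] := IH (T :\ i) V m' (upd i (p i + m'%:Z)%R p) r' cTi VTi m'0.
  by rewrite cV ltnW.
set B := Box p (sides m' V T).
have Ci x : x \in C -> x i = (p i + m'%:Z)%R.
  move=> /(fsubsetP CB); rewrite in_Box => /forallP/(_ i).
  rewrite updE eqxx /sides (negbTE iV) !inE eqxx /=.
  by move: (x i) (p i + m'%:Z)%R => u w; lia.
have si : sides m' V T i = m' by rewrite /sides (negbTE iV) iT.
have dBC : B `&` C = fset0.
  apply/eqP/fdisjointP => x; rewrite in_Box => /forallP/(_ i) xB.
  apply/negP => /Ci xi; move: xB; rewrite si xi.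
  by rewrite ltxx andbF.
have CBV : C `<=` Box p (sides m' (i |: V) T).
  apply/fsubsetP => x xC; have := fsubsetP CB x xC; rewrite !in_Box => /forallP xB.
  apply/forallP => j; have := xB j; rewrite updE /sides !inE.
  case: eqP => [->|_] //=; rewrite (negbTE iV).
  by move: (p i) (x i) => u v; lia.
exists (B `|` C); split.
- rewrite fsubUset Box_sub //=; have [e|r'0] := posnP r'.
    by move: cC; rewrite e => /cardfs0_eq ->; rewrite fsub0set.
  exact: fsubset_trans CBV (Box_sub _ (fitS r'0)).
- by rewrite cardfsU dBC cardfs0 subn0 card_Box_sides // cC cV cT er.
have surfE : \sum_(j in T) box m' #|V :\ j| k = surf m' l k.+1.
  rewrite (big_setID V) /= (setIidPr VT) /surf; congr (_ + _).
    rewrite (eq_bigr (fun=> box m' l.-1 k)) ?sum_nat_const ?cV // => j jV.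
    by move: cV; rewrite (cardsD1 j) jV => <-.
  rewrite (eq_bigr (fun=> box m' l k)).
    by rewrite sum_nat_const cardsD (setIidPr VT) cV cT.
  move=> j; rewrite inE => /andP[jV _]; congr box; rewrite -cV.
  by rewrite [RHS](cardsD1 j) (negbTE jV).
rewrite er del_box_add //; last exact: ltnW.
rewrite -surfE; apply: leq_trans (leq_add (leqnn _) tC).
(* In direction [i] the attached piece adds no tops; in the other directions the tops of the union
   are tops of one of the parts. *)
rewrite !(big_setD1 i iT) /= -addnA -big_split leq_add //.
  have := card_tops_attach m'0 VT iTV CB; rewrite cT.
  by rewrite [#|V|](cardsD1 i) (negbTE iV).
apply: leq_sum => j; rewrite !inE => /andP[_ jT].
apply: (@leq_trans #|` tops j B `|` tops j C|).
  apply: fsubset_leq_card; apply/fsubsetP => x; rewrite !inE negb_or.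
  by case/andP => /orP[->|->] /andP[-> ->]; rewrite ?orbT.
rewrite cardfsU; apply: leq_trans (leq_subr _ _) _; rewrite leq_add2r.
by have := card_tops_Box_sides p m'0 VT jT; rewrite cT.
Qed.

Lemma exists_num_edges n (hd : 0 < d) :
  exists C, [/\ {subset C <= @pos_grid d}, #|` C| = n & del d n + num_edges C = d * n].
Proof.
pose p : grid d := [ffun=> 1%R].
have cT : #|[set: 'I_d]| = d by rewrite cardsT card_ord.
(* A cube of side [n.+1] has room for [n] points, and its lowest corner [p] keeps it inside
   [pos_grid]. *)
have nb : n <= box n.+1 #|@set0 'I_d| d.
  rewrite cards0 box0; apply: leq_trans (leqnSn n) _.
  by rewrite -{1}[n.+1]expn1 leq_pexp2l.
have [C [CB cC tC]] := exists_tops_le p cT (sub0set _) (ltn0Sn n) nb.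
exists C; split=> //.
  move=> x /(fsubsetP CB); rewrite in_Box => /forallP xB; apply/forallP => i.
  by have /andP[+ _] := xB i; rewrite ffunE.
have h1 := del_num_edges_le C; have h2 := num_edges_tops C; rewrite cC in h1 h2.
have h3 : \sum_(i < d) #|` tops i C| <= del d n.
  by apply: leq_trans tC; apply: eq_leq; apply: eq_bigl => i; rewrite inE.
lia.
Qed.

End Construction.

(** * Pseudo-cubic representations *)

Lemma bracketE m l j : l <= j -> bracket m l%:Z j = ((box m l j)%:R)%R.
Proof.
by move=> lj; rewrite /bracket subzn // -!exprnP natrM !natrX.
Qed.

Lemma delta_term m l i : l < i ->
  (l%:R * bracket m (l%:Z - 1) i.-1 + (i%:R - l%:R) * bracket m l%:Z i.-1 =
   (surf m l i)%:R)%R.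
Proof.
case: i => // i li; rewrite /= bracketE // natrD !natrM natrB 1?ltnW //.
(* The exponent [-1] arises only for [l = 0], where its factor vanishes. *)
congr (_ + _)%R; case: l li => [|l] li; first by rewrite !mul0r.
by rewrite /= intS addrAC subrr add0r bracketE 1?ltnW // natrM.
Qed.

(* The partial sums of a PCR stay below the next pseudo-cube, so that they are
   a legal remainder for the next term. *)
Lemma del_PCR d c (m l : nat -> nat) : c <= d ->
  (forall i, c <= i <= d -> 0 < m i /\ l i < i) ->
  (forall i, c <= i < d ->
     m i < m i.+1 \/ m i = m i.+1 /\ l i < l i.+1) ->
  let n := \sum_(c <= i < d.+1) box (m i) (l i) i in
  n < box (m d) (l d).+1 d /\
  del d n = \sum_(c <= i < d.+1) surf (m i) (l i) i.
Proof.
move=> /subnKC <-; elim: (d - c) => [|k IH] ml lex /=.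
  have [m0 lc] := ml (c + 0) ltac:(lia).
  rewrite addn0 !big_nat1 in m0 lc *.
  by split; [apply: ltn_boxS|rewrite del_boxn // ltnW].
rewrite addnS in ml lex *.
have [ck] : _ /\ _ := IH (fun i ci => ml i ltac:(lia)) (fun i ci => lex i ltac:(lia)).
rewrite !(@big_nat_recr _ _ _ (c + k).+1) /=; try lia.
set n := \sum_(c <= i < _) box _ _ _ => dn.
have [m0 lc] := ml (c + k).+1 ltac:(lia).
have [m1 l1] := ml (c + k) ltac:(lia).
have nb : n < box (m (c + k).+1) (l (c + k).+1) (c + k).
  apply: leq_trans ck _; apply: box_lex => //; apply: lex; lia.
split; first by rewrite boxS // addnC ltn_add2l.
by rewrite [n + _]addnC del_box_add // 1?ltnW // dn addnC.
Qed.

Local Open Scope ring_scope.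

Theorem theorem6p4 (d n c : nat) (m l : nat -> nat)
    (hd : (1 <= d)%N) (hn : (1 <= n)%N) (hPCR : is_PCR d n c m l) :
  exists e : nat,
    [/\ is_max_edges n (@predT (grid d)) e,
        is_max_edges n (@pos_grid d) e
      & e%:R = d%:R * n%:R - delta d c m l].
Proof.
case: hPCR => /andP[_ cd] ml lex en.
have {}en : n = (\sum_(c <= i < d.+1) box (m i) (l i) i)%N.
  apply/eqP; rewrite -(eqr_nat rat) en natr_sum; apply/eqP.
  apply: eq_big_nat => i /ml[_ li]; rewrite bracketE // ltnW //.
have [|_ edel] := del_PCR cd ml.
  by move=> i /lex; rewrite ltxi_pair !leEnat ltEnat /=; lia.
have eD : delta d c m l = (del d n)%:R.
  rewrite en edel natr_sum; apply: eq_big_nat => i /ml[_ li].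
  exact: delta_term.
have [C [CV cC eC]] := exists_num_edges n hd.
have ub (S : {fset grid d}) : #|` S| = n -> (num_edges S <= d * n - del d n)%N.
  by move=> <-; have := del_num_edges_le S; lia.
(* The bound [ub] holds in the whole grid and the witness [C] lies in [pos_grid], so one value
   serves both maxima. *)
exists (d * n - del d n)%N; split.
- by split=> [|S _]; [exists C; split=> //; lia|apply: ub].
- by split=> [|S _]; [exists C; split=> //; lia|apply: ub].
rewrite eD natrB ?natrM //; lia.
Qed.
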